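(* Let $(V,\circ,[\cdot,\cdot])$ be a Gel'fand-Dorfman bialgebra over $\mathbb{C}$, and set $a\ast b=a\circ b+b\circ a$ for $a,b\in V$. If $(V,\ast)$ is a simple Novikov-Jordan algebra, then the quadratic Lie conformal algebra $R=\mathbb{C}[\partial]V$ corresponding to $(V,\circ,[\cdot,\cdot])$ is simple.
   Context: All vector spaces are over $\mathbb{C}$. A Lie conformal algebra is a $\mathbb{C}[\partial]$-module $R$ with a $\mathbb{C}$-bilinear $\lambda$-bracket $[\cdot_\lambda\cdot]:R\times R\to R[\lambda]=R\otimes\mathbb{C}[\lambda]$ such that for all $a,b,c\in R$: $[\partial a_\lambda b]=-\lambda[a_\lambda b]$ and $[a_\lambda\partial b]=(\lambda+\partial)[a_\lambda b]$; $[a_\lambda b]=-[b_{-\lambda-\partial}a]$; $[a_\lambda[b_\mu c]]=[[a_\lambda b]_{\lambda+\mu}c]+[b_\mu[a_\lambda c]]$. For subspaces $A,B\subset R$, $[A,B]$ is the $\mathbb{C}$-linear span of all coefficients (in powers of $\lambda$) of $[a_\lambda b]$, $a\in A$, $b\in B$. An ideal of $R$ is a $\mathbb{C}[\partial]$-submodule $I\subset R$ with $[R,I]\subset I$. $R$ is abelian if $[R,R]=0$, and simple if it is not abelian and its only ideals are $0$ and $R$. A Novikov algebra is a vector space $V$ with a bilinear product $\circ$ satisfying $(a\circ b)\circ c-a\circ(b\circ c)=(b\circ a)\circ c-b\circ(a\circ c)$ and $(a\circ b)\circ c=(a\circ c)\circ b$. Given a Novikov algebra $(V,\circ)$, the commutative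 algebra $(V,\ast)$ with $a\ast b=a\circ b+b\circ a$ is called its Novikov-Jordan algebra. An ideal of $(V,\ast)$ is a subspace $I$ with $a\ast b\in I$ for all $a\in I$, $b\in V$. $(V,\ast)$ is simple if its only ideals are $0$ and $V$ and $a\ast b\neq0$ for some $a,b\in V$. A Gel'fand-Dorfman bialgebra $(V,\circ,[\cdot,\cdot])$ is a vector space $V$ with a Lie bracket $[\cdot,\cdot]$ and a product $\circ$ such that $(V,\circ)$ is a Novikov algebra and $[a\circ b,c]-[a\circ c,b]+[a,b]\circ c-[a,c]\circ b-a\circ[b,c]=0$ for all $a,b,c\in V$. The quadratic Lie conformal algebra corresponding to $(V,\circ,[\cdot,\cdot])$ is the free $\mathbb{C}[\partial]$-module $R=\mathbb{C}[\partial]V=\mathbb{C}[\partial]\otimes V$ with the $\lambda$-bracket determined by $[a_\lambda b]=\partial(b\circ a)+[b,a]+\lambda(a\circ b+b\circ a)$ for $a,b\in V$. *)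

(* Defs.v *)
From HB Require Import structures.
From mathcomp Require Import all_boot all_order all_algebra.
From mathcomp Require Import finmap monalg.
From mathcomp Require Import boolp classical_sets.
From mathcomp Require Import ring.

Set Implicit Arguments.
Unset Strict Implicit.
Unset Printing Implicit Defensive.

Import GRing.Theory.
Local Open Scope ring_scope.
Local Open Scope classical_set_scope.

(* M[X] = A[X] (x)_A M: finitely supported sequences of coefficients in M. It
   is used both for the free module C[d] (x) V (over A = C, M = V) and for
   R[lambda] (over A = C[d], M = R), R[lambda][mu], etc. The module structure
   over {poly A} is the convolution product. *)
Definition modpoly (A : comNzRingType) (M : lmodType A) : Type := {malg M[nat]}.

HB.instance Definition _ (A : comNzRingType) (M : lmodType A) :=
  GRing.Zmodule.on (modpoly M).

(* Locked so that unification does not unfold iterated modpoly structures. *)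
HB.lock Definition modpoly_scale (A : comNzRingType) (M : lmodType A)
    (p : {poly A}) (f : modpoly M) : modpoly M :=
  \sum_(i < size p) \sum_(k <- msupp f) << p`_i *: f@_k *g (i + k)%N >>.

HB.lock Definition mconst (A : comNzRingType) (M : lmodType A) (x : M) :
  modpoly M := << x *g 0%N >>.

Section ModPoly.
Variables (A : comNzRingType) (M : lmodType A).

Implicit Types (a : A) (x y : M) (p q : {poly A}) (f g : modpoly M).

Lemma modpoly_scaleE p f n :
  (modpoly_scale p f)@_n = \sum_(i < n.+1) p`_i *: f@_(n - i)%N.
Proof.
pose F (i : nat) : M := p`_i *: f@_(n - i)%N.
transitivity (\sum_(i < size p | (i < n.+1)%N) F i).
  rewrite modpoly_scale.unlock raddf_sum /= [RHS]big_mkcond; apply: eq_bigr => i _ /=.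
  rewrite raddf_sum /=; under eq_bigr do rewrite mcoeffU.
  rewrite ltnS; case: leqP => ni; last first.
    rewrite big1 // => k _; case: eqP => // E.
    by move: ni; rewrite -E ltnNge leq_addr.
  have [ks|ks] := boolP ((n - i)%N \in msupp f).
    rewrite (big_fsetD1 (n - i)%N) //= subnKC // eqxx mulr1n big1_fset ?addr0 //.
    move=> k; rewrite in_fsetD1 => /andP[kni _] _.
    by case: eqP => // E; move: kni; rewrite -E addKn eqxx.
  rewrite /F (mcoeff_outdom ks) scaler0 big1_fset // => k kf _.
  by case: eqP => // E; move: ks; rewrite -E addKn kf.
pose N := maxn (size p) n.+1.
rewrite (big_ord_widen_cond N (fun i => i < n.+1)%N F) ?leq_maxl //.
rewrite [RHS](big_ord_widen N F) ?leq_maxr //=.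
rewrite [RHS](bigID (fun i : 'I_N => i < size p)%N) /=.
rewrite [X in _ = _ + X]big1 ?addr0 //.
by move=> i /andP[_]; rewrite -leqNgt /F => /(nth_default 0) ->; rewrite scale0r.
Qed.

Fact modpoly_scaleDl f p q :
  modpoly_scale (p + q) f = modpoly_scale p f + modpoly_scale q f.
Proof.
apply/malgP => n; rewrite mcoeffD !modpoly_scaleE -big_split /=.
by apply: eq_bigr => i _; rewrite coefD scalerDl.
Qed.

Fact modpoly_scaleDr p f g :
  modpoly_scale p (f + g) = modpoly_scale p f + modpoly_scale p g.
Proof.
apply/malgP => n; rewrite mcoeffD !modpoly_scaleE -big_split /=.
by apply: eq_bigr => i _; rewrite mcoeffD scalerDr.
Qed.

Lemma modpoly_scaleXn a i f n :
  (modpoly_scale (a *: 'X^i) f)@_n = if (i <= n)%N then a *: f@_(n - i)%N else 0.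
Proof.
rewrite modpoly_scaleE; case: leqP => ni.
  rewrite (bigD1 (Ordinal (ni : i < n.+1)%N)) //= coefZ coefXn eqxx mulr1.
  rewrite big1 ?addr0 // => j ji; rewrite coefZ coefXn.
  by rewrite -(inj_eq val_inj) /= in ji; rewrite (negPf ji) mulr0 scale0r.
rewrite big1 // => j _; rewrite coefZ coefXn.
by rewrite ltn_eqF ?mulr0 ?scale0r // (leq_trans _ ni) // ltn_ord.
Qed.

Fact modpoly_scaleA p q f :
  modpoly_scale p (modpoly_scale q f) = modpoly_scale (p * q) f.
Proof.
have S0l g : modpoly_scale 0 g = 0.
  by apply: (addrI (modpoly_scale 0 g)); rewrite -modpoly_scaleDl !addr0.
have S0r r : modpoly_scale r 0 = 0 :> modpoly M.
  by apply: (addrI (modpoly_scale r 0)); rewrite -modpoly_scaleDr !addr0.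
rewrite -(coefK p) poly_def mulr_suml.
elim/big_rec2: _ => [|i r s _ E]; first by rewrite !S0l.
rewrite !modpoly_scaleDl E; congr (_ + _); rewrite -(coefK q) poly_def mulr_sumr.
elim/big_rec2: _ => [|j {}r {}s _ {}E]; first by rewrite !S0l S0r.
rewrite !modpoly_scaleDl modpoly_scaleDr E; congr (_ + _).
rewrite -scalerAl -scalerAr scalerA -exprD.
apply/malgP => n; rewrite !modpoly_scaleXn subnDA.
case: (leqP i n) => [ni|ni]; last first.
  by rewrite leqNgt (leq_trans ni (leq_addr _ _)).
rewrite -leq_subRL //.
by case: ifP; rewrite ?scaler0 // scalerA.
Qed.

Fact modpoly_scale1 f : modpoly_scale 1 f = f.
Proof.
apply/malgP => n; rewrite -[1 : {poly A}]scale1r -[X in _ *: X](expr0 'X).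
by rewrite modpoly_scaleXn /= subn0 scale1r.
Qed.

HB.instance Definition _ := GRing.Zmodule_isLmodule.Build {poly A} (modpoly M)
  modpoly_scaleA modpoly_scale1 modpoly_scaleDr modpoly_scaleDl.

Lemma mcoeff_scaleXn a i f n :
  ((a *: 'X^i) *: f : modpoly M)@_n = if (i <= n)%N then a *: f@_(n - i)%N else 0.
Proof. exact: modpoly_scaleXn. Qed.

Lemma mconstD x y : mconst (x + y) = mconst x + mconst y.
Proof. by rewrite mconst.unlock; exact: monalgUD. Qed.

Lemma mconstN x : mconst (- x) = - mconst x.
Proof. by rewrite mconst.unlock; exact: monalgUN. Qed.

Lemma mconstZ a x : mconst (a *: x) = a%:P *: mconst x.
Proof.
rewrite mconst.unlock; apply/malgP => n; rewrite -alg_polyC -(expr0 'X).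
by rewrite mcoeff_scaleXn subn0 !mcoeffU -scalerMnr.
Qed.

Lemma mscaleXnU i x : 'X^i *: mconst x = << x *g i >>.
Proof.
rewrite mconst.unlock; apply/malgP => n; rewrite -['X^i]scale1r mcoeff_scaleXn !mcoeffU scale1r.
case: leqP => [|ni]; last by rewrite gtn_eqF.
by move=> le_in; rewrite [in RHS]eqn_leq le_in /= -subn_eq0 eq_sym.
Qed.

Lemma modpolyE f : f = \sum_(k <- msupp f) 'X^k *: mconst f@_k.
Proof. by rewrite {1}[f]monalgE; apply: eq_bigr => k _; rewrite mscaleXnU. Qed.

End ModPoly.

(* \sum_k X^k m_k is sent to \sum_k u^k g(m_k). *)
HB.lock Definition msubst (A B : comNzRingType) (M : lmodType A) (N : lmodType B)
    (g : M -> N) (u : B) (f : modpoly M) : N :=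
  \sum_(k <- msupp f) u ^+ k *: g f@_k.

Section MsubstTheory.
Variables (A B : comNzRingType) (M : lmodType A) (N : lmodType B).

Lemma modpoly_eq (F G : modpoly M -> N) (u : B) :
    {morph F : x y / x + y} -> {morph G : x y / x + y} ->
    (forall f, F ('X *: f) = u *: F f) -> (forall f, G ('X *: f) = u *: G f) ->
    (forall x, F (mconst x) = G (mconst x)) ->
  F =1 G.
Proof.
move=> FD GD FX GX FG f.
have F0 : F 0 = 0 by apply: (addrI (F 0)); rewrite -FD !addr0.
have G0 : G 0 = 0 by apply: (addrI (G 0)); rewrite -GD !addr0.
rewrite [f]modpolyE (big_morph F FD F0) (big_morph G GD G0).
apply: eq_bigr => k _; move: (f@_k) => x; elim: k => [|k IH]; first by rewrite expr0 !scale1r.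
by rewrite exprS -!scalerA FX GX IH.
Qed.

Variables (g : M -> N) (u : B).
Hypothesis gD : {morph g : x y / x + y}.

Let g0 : g 0 = 0.
Proof. by apply: (addrI (g 0)); rewrite -gD !addr0. Qed.

Lemma msubstEw (d : {fset nat}) f : (msupp f `<=` d)%fset ->
  msubst g u f = \sum_(k <- d) u ^+ k *: g f@_k.
Proof.
move=> le; rewrite msubst.unlock; apply: big_fset_incl => // k _ kf.
by rewrite mcoeff_outdom // g0 scaler0.
Qed.

Lemma msubstD : {morph msubst g u : x y / x + y}.
Proof.
move=> x y; set d := (msupp x `|` msupp y)%fset.
rewrite (@msubstEw d (x + y)) ?msuppD_le // (@msubstEw d x) ?fsubsetUl //.
rewrite (@msubstEw d y) ?fsubsetUr // -big_split /=.
by apply: eq_bigr => k _; rewrite mcoeffD gD scalerDr.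
Qed.

Lemma msubstU x i : msubst g u << x *g i >> = u ^+ i *: g x.
Proof.
by rewrite (@msubstEw [fset i]%fset) ?msuppU_le // big_seq_fset1 mcoeffUU.
Qed.

Lemma msubst_const x : msubst g u (mconst x) = g x.
Proof. by rewrite -[mconst _]scale1r -(expr0 'X) mscaleXnU msubstU scale1r. Qed.

Lemma msubst_sum I (r : seq I) (F : I -> modpoly M) :
  msubst g u (\sum_(i <- r) F i) = \sum_(i <- r) msubst g u (F i).
Proof. by apply: big_morph; [exact: msubstD | rewrite msubst.unlock msupp0 big_seq_fset0]. Qed.

Lemma msubstX f : msubst g u ('X *: f) = u *: msubst g u f.
Proof.
rewrite {1}[f]modpolyE scaler_sumr msubst_sum [in RHS]msubst.unlock scaler_sumr.
apply: eq_bigr => k _.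
by rewrite scalerA -exprS mscaleXnU msubstU scalerA exprS.
Qed.

Lemma msubstC a b f : (forall x, g (a *: x) = b *: g x) ->
  msubst g u (a%:P *: f) = b *: msubst g u f.
Proof.
move=> gZ; rewrite {1}[f]modpolyE scaler_sumr msubst_sum [in RHS]msubst.unlock scaler_sumr.
apply: eq_bigr => k _.
by rewrite scalerA mulrC -scalerA -mconstZ mscaleXnU msubstU gZ !scalerA mulrC.
Qed.

Lemma msubstNX f : msubst g u ((- 'X) *: f) = (- u) *: msubst g u f.
Proof.
apply: (addrI (u *: msubst g u f)).
rewrite -[X in X + _ = _]msubstX -msubstD -!scalerDl !subrr !scale0r.
by rewrite msubst.unlock msupp0 big_seq_fset0.
Qed.

Lemma msubstXDC a b f : (forall x, g (a *: x) = b *: g x) ->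
  msubst g u (('X + a%:P) *: f) = (u + b) *: msubst g u f.
Proof. by move=> gZ; rewrite !scalerDl msubstD msubstX (msubstC _ gZ). Qed.

End MsubstTheory.

Lemma msubst_scalel (A B : comNzRingType) (M : lmodType A) (N : lmodType B)
    (g h : M -> N) (s u : B) f : (forall x, g x = s *: h x) ->
  msubst g u f = s *: msubst h u f.
Proof.
move=> gh; rewrite msubst.unlock scaler_sumr; apply: eq_bigr => k _.
by rewrite gh !scalerA mulrC.
Qed.

Lemma msubst_addl (A B : comNzRingType) (M : lmodType A) (N : lmodType B)
    (g h k : M -> N) (u : B) f : (forall x, g x = h x + k x) ->
  msubst g u f = msubst h u f + msubst k u f.
Proof.
move=> ghk; rewrite msubst.unlock -big_split; apply: eq_bigr => i _.
by rewrite ghk scalerDr.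
Qed.

HB.mixin Record Lmodule_isNovikov (K : fieldType) V of GRing.Lmodule K V := {
  circ : V -> V -> V;
  circ_bilinear : bilinear_for *:%R *:%R circ;
  circ_lsym : forall a b c,
    circ (circ a b) c - circ a (circ b c) = circ (circ b a) c - circ b (circ a c);
  circ_rcomm : forall a b c, circ (circ a b) c = circ (circ a c) b }.

#[short(type="novikovType")]
HB.structure Definition Novikov (K : fieldType) :=
  {V of GRing.Lmodule K V & Lmodule_isNovikov K V}.

HB.mixin Record Lmodule_isLie (K : fieldType) V of GRing.Lmodule K V := {
  brk : V -> V -> V;
  brk_bilinear : bilinear_for *:%R *:%R brk;
  brk_alt : forall a, brk a a = 0;
  brk_jacobi : forall a b c,
    brk a (brk b c) + brk b (brk c a) + brk c (brk a b) = 0 }.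

#[short(type="lieType")]
HB.structure Definition LieAlg (K : fieldType) :=
  {V of GRing.Lmodule K V & Lmodule_isLie K V}.

HB.mixin Record NovikovLie_isGelfandDorfman (K : fieldType) V
    of Novikov K V & LieAlg K V := {
  gd_compat : forall a b c : V,
    brk (circ a b) c - brk (circ a c) b + circ (brk a b) c - circ (brk a c) b
      - circ a (brk b c) = 0 }.

#[short(type="gelfandDorfmanType")]
HB.structure Definition GelfandDorfman (K : fieldType) :=
  {V of Novikov K V & LieAlg K V & NovikovLie_isGelfandDorfman K V}.

Definition jmul (K : fieldType) (V : novikovType K) (a b : V) : V :=
  circ a b + circ b a.

Definition nj_ideal (K : fieldType) (V : novikovType K) (I : set V) : Prop :=
  GRing.submod_closed [in I] /\ (forall a b, I a -> I (jmul a b)).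

Definition nj_simple (K : fieldType) (V : novikovType K) : Prop :=
  (forall I : set V, nj_ideal I -> I = [set 0] \/ I = [set: V])
  /\ (exists a b : V, jmul a b <> 0).

(* [a_u b] in R[lambda][mu], for u a polynomial in d, lambda and mu, which are
   'X%:P%:P, 'X%:P and 'X respectively. *)
Definition lbr_at (K : fieldType) (R : lmodType {poly K})
    (lbr : R -> R -> modpoly R) (u : {poly {poly {poly K}}}) (a b : R) :
  modpoly (modpoly R) :=
  msubst (fun x => mconst (mconst x)) u (lbr a b).

(* A module over C[d] is an lmodType over {poly K}, with d = 'X. In R[lambda],
   seen as a module over C[d][lambda], lambda is 'X, d is 'X%:P and a scalar c
   is c%:P%:P. *)
HB.mixin Record PolyLmodule_isLieConformal (K : fieldType) R
    of GRing.Lmodule {poly K} R := {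
  lbr : R -> R -> modpoly R;
  lbrDl : forall a a' b, lbr (a + a') b = lbr a b + lbr a' b;
  lbrDr : forall a b b', lbr a (b + b') = lbr a b + lbr a b';
  lbrZl : forall (c : K) a b, lbr (c%:P *: a) b = c%:P%:P *: lbr a b;
  lbrZr : forall (c : K) a b, lbr a (c%:P *: b) = c%:P%:P *: lbr a b;
  lbrXl : forall a b, lbr ('X *: a) b = (- 'X) *: lbr a b;
  lbrXr : forall a b, lbr a ('X *: b) = ('X + 'X%:P) *: lbr a b;
  lbr_skew : forall a b,
    lbr a b = - msubst (@mconst _ R) (- 'X - 'X%:P) (lbr b a);
  lbr_jacobi : forall a b c,
    msubst (lbr_at lbr 'X%:P a) 'X (lbr b c)
    = msubst (fun x => lbr_at lbr ('X%:P + 'X) x c) 'X%:P (lbr a b)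
      + msubst (lbr_at lbr 'X b) 'X%:P (lbr a c) }.

#[short(type="lieConformalType")]
HB.structure Definition LieConformal (K : fieldType) :=
  {R of GRing.Lmodule {poly K} R & PolyLmodule_isLieConformal K R}.

Section Ideals.
Variables (K : fieldType) (R : lieConformalType K).

Definition lbr_coefs (A B : set R) : set R :=
  [set x | exists a b n, [/\ A a, B b & x = (lbr a b)@_n]].

Definition cspan (S : set R) : set R :=
  [set x | exists s : seq (K * R),
    {in s, forall z, S z.2} /\ x = \sum_(z <- s) z.1%:P *: z.2].

Definition bracket_set (A B : set R) : set R := cspan (lbr_coefs A B).

Definition lca_ideal (I : set R) : Prop :=
  GRing.submod_closed [in I] /\ bracket_set [set: R] I `<=` I.

Definition lca_abelian : Prop := bracket_set [set: R] [set: R] = [set 0].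

Definition lca_simple : Prop :=
  ~ lca_abelian /\ (forall I, lca_ideal I -> I = [set 0] \/ I = [set: R]).

End Ideals.

(* The square-zero extension A (+) M is a commutative ring in which M embeds;
   the ring tactic thereby decides linear identities in M. *)
Definition sqz (A : comNzRingType) (M : lmodType A) : Type := (A * M)%type.

Section SquareZero.
Variables (A : comNzRingType) (M : lmodType A).
HB.instance Definition _ := GRing.Zmodule.on (sqz M).
Definition sqz_mul (x y : sqz M) : sqz M := (x.1 * y.1, x.1 *: y.2 + y.1 *: x.2).
Fact sqz_mulC : commutative sqz_mul.
Proof. by move=> [a x] [b y]; rewrite /sqz_mul /= (mulrC a) (addrC (a *: y)). Qed.
Fact sqz_mulA : associative sqz_mul.
Proof.
move=> [a x] [b y] [c z]; rewrite /sqz_mul /= mulrA !scalerDr !scalerA.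
by rewrite addrA (mulrC c a) (mulrC c b).
Qed.
Fact sqz_mul1 : left_id ((1, 0) : sqz M) sqz_mul.
Proof. by move=> [a x]; rewrite /sqz_mul /= mul1r scale1r scaler0 addr0. Qed.
Fact sqz_mulD : left_distributive sqz_mul +%R.
Proof.
move=> [a x] [b y] [c z]; apply/eqP; rewrite /sqz_mul xpair_eqE /=.
by rewrite mulrDl scalerDl scalerDr addrACA !eqxx.
Qed.
Fact sqz_1neq0 : ((1, 0) : sqz M) != 0.
Proof. by rewrite xpair_eqE oner_eq0. Qed.
HB.instance Definition _ := GRing.Zmodule_isComNzRing.Build (sqz M)
  sqz_mulA sqz_mulC sqz_mul1 sqz_mulD sqz_1neq0.
Definition sqzl (a : A) : sqz M := (a, 0).
Definition sqzr (m : M) : sqz M := (0, m).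
Lemma sqzr_inj : injective sqzr. Proof. by move=> x y []. Qed.
Lemma sqzrD x y : sqzr (x + y) = sqzr x + sqzr y.
Proof. by apply/eqP; rewrite xpair_eqE /= addr0 !eqxx. Qed.
Lemma sqzrN x : sqzr (- x) = - sqzr x.
Proof. by apply/eqP; rewrite xpair_eqE /= oppr0 !eqxx. Qed.
Lemma sqzr0 : sqzr 0 = 0. Proof. by []. Qed.
Lemma sqzrZ a x : sqzr (a *: x) = sqzl a * sqzr x.
Proof. by apply/eqP; rewrite xpair_eqE /= mulr0 scale0r addr0 !eqxx. Qed.
Lemma sqzlD a b : sqzl (a + b) = sqzl a + sqzl b.
Proof. by apply/eqP; rewrite xpair_eqE /= addr0 !eqxx. Qed.
Lemma sqzlN a : sqzl (- a) = - sqzl a.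
Proof. by apply/eqP; rewrite xpair_eqE /= oppr0 !eqxx. Qed.
Lemma sqzlM a b : sqzl (a * b) = sqzl a * sqzl b.
Proof. by apply/eqP; rewrite xpair_eqE /= !scaler0 addr0 !eqxx. Qed.
Definition sqzE := (sqzrD, sqzrN, sqzr0, sqzrZ, sqzlD, sqzlN, sqzlM).
End SquareZero.

Local Ltac module_ring := apply: sqzr_inj; rewrite !sqzE; ring.

Section GDTheory.
Variables (K : fieldType) (V : gelfandDorfmanType K).
Implicit Types a b c : V.
Lemma circDl a b c : circ (a + b) c = circ a c + circ b c.
Proof. by have := circ_bilinear.1 c 1 a b; rewrite /= !scale1r. Qed.
Lemma circDr a b c : circ a (b + c) = circ a b + circ a c.
Proof. by have := circ_bilinear.2 a 1 b c; rewrite /= !scale1r. Qed.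
Lemma circ0l c : circ 0 c = 0 :> V.
Proof. by apply: (addrI (circ 0 c)); rewrite -circDl !addr0. Qed.
Lemma circ0r a : circ a 0 = 0 :> V.
Proof. by apply: (addrI (circ a 0)); rewrite -circDr !addr0. Qed.
Lemma circZl k a c : circ (k *: a) c = k *: circ a c.
Proof. by have := circ_bilinear.1 c k a 0; rewrite /= !addr0 circ0l addr0. Qed.
Lemma circZr k a c : circ a (k *: c) = k *: circ a c.
Proof. by have := circ_bilinear.2 a k c 0; rewrite /= !addr0 circ0r addr0. Qed.
Lemma brkDl a b c : brk (a + b) c = brk a c + brk b c.
Proof. by have := brk_bilinear.1 c 1 a b; rewrite /= !scale1r. Qed.
Lemma brkDr a b c : brk a (b + c) = brk a b + brk a c.
Proof. by have := brk_bilinear.2 a 1 b c; rewrite /= !scale1r. Qed.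
Lemma brk0l c : brk 0 c = 0 :> V.
Proof. by apply: (addrI (brk 0 c)); rewrite -brkDl !addr0. Qed.
Lemma brk0r a : brk a 0 = 0 :> V.
Proof. by apply: (addrI (brk a 0)); rewrite -brkDr !addr0. Qed.
Lemma brkZl k a c : brk (k *: a) c = k *: brk a c.
Proof. by have := brk_bilinear.1 c k a 0; rewrite /= !addr0 brk0l addr0. Qed.
Lemma brkZr k a c : brk a (k *: c) = k *: brk a c.
Proof. by have := brk_bilinear.2 a k c 0; rewrite /= !addr0 brk0r addr0. Qed.
Lemma circNl a c : circ (- a) c = - circ a c.
Proof. by rewrite -scaleN1r circZl scaleN1r. Qed.
Lemma circNr a c : circ a (- c) = - circ a c.
Proof. by rewrite -scaleN1r circZr scaleN1r. Qed.
Lemma brkNl a c : brk (- a) c = - brk a c.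
Proof. by rewrite -scaleN1r brkZl scaleN1r. Qed.
Lemma brkNr a c : brk a (- c) = - brk a c.
Proof. by rewrite -scaleN1r brkZr scaleN1r. Qed.
Lemma brkC a b : brk a b = - brk b a.
Proof.
apply/eqP; rewrite -addr_eq0; apply/eqP; have := brk_alt (a + b).
by rewrite brkDl !brkDr !brk_alt add0r addr0.
Qed.

Lemma gd_jacobi (P : comNzRingType) (N : lmodType P) (i : V -> N) (L U D : P) a b c
    (T := fun t a b => D *: i (circ b a) + i (brk b a) + t *: i (jmul a b)) :
  {morph i : x y / x + y} -> {morph i : x / - x} ->
  (L + D) *: T L a (circ c b) + T L a (brk c b) + U *: T L a (jmul b c)
  = - (L + U) *: T (L + U) (circ b a) c + T (L + U) (brk b a) c
      + L *: T (L + U) (jmul a b) c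
    + ((U + D) *: T U b (circ c a) + T U b (brk c a) + L *: T U b (jmul a c)).
Proof.
move=> iD iN; rewrite {}/T /jmul.
rewrite !(circDl, circDr, brkDl, brkDr) (brkC b a) (brkC c a) (brkC c b).
rewrite !(circNl, circNr, brkNl, brkNr).
rewrite (brkC c (circ a b)) (brkC c (circ b a)) (brkC c (brk a b)).
have -> : brk (brk a b) c = brk (brk a c) b - brk (brk b c) a.
  have := brk_jacobi a b c.
  rewrite (brkC c a) brkNr (brkC a) (brkC b (brk a c)) (brkC c (brk a b)) opprK.
  by move/eqP; rewrite subr_eq0 addrC => /eqP.
have -> : brk (circ a c) b
    = brk (circ a b) c + circ (brk a b) c - circ (brk a c) b - circ a (brk b c).
  by apply/esym/eqP; rewrite -subr_eq0 -(gd_compat a b c); apply/eqP; module_ring.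
have -> : brk (circ b c) a
    = brk (circ b a) c - circ (brk a b) c - circ (brk b c) a - circ b (brk a c).
  apply/esym/eqP; rewrite -subr_eq0 -(gd_compat b a c) (brkC b a) circNl.
  by apply/eqP; module_ring.
have -> : brk (circ c b) a
    = brk (circ c a) b - circ (brk a c) b + circ (brk b c) a - circ c (brk a b).
  apply/esym/eqP; rewrite -subr_eq0 -(gd_compat c a b) (brkC c a) (brkC c b) !circNl.
  by apply/eqP; module_ring.
rewrite (circ_rcomm c b a) (circ_rcomm a c b) (circ_rcomm b c a).
have lsym x y z : circ x (circ y z) = circ (circ x y) z - circ (circ y x) z + circ y (circ x z) :> V.
  by have /eqP := circ_lsym x y z; rewrite subr_eq => /eqP ->; module_ring.
rewrite (lsym a b c) (lsym b c a) (lsym a c b).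
rewrite (circ_rcomm a c b) (circ_rcomm c b a) (circ_rcomm b c a).
rewrite !(iD, iN).
module_ring.
Qed.

End GDTheory.

Definition quadratic (K : fieldType) (V : gelfandDorfmanType K) : Type := modpoly V.

Section Quadratic.
Variables (K : fieldType) (V : gelfandDorfmanType K).
Implicit Types (a b c : V).

HB.instance Definition _ := GRing.Lmodule.on (quadratic V).
Local Notation R := (quadratic V).
Implicit Types (f g h : R).

Definition quad_gen a b : modpoly R :=
  mconst ('X *: mconst (circ b a) + mconst (brk b a) : R)
    + 'X *: mconst (mconst (jmul a b) : R).

Lemma msubst_quad_gen (B : comNzRingType) (N : lmodType B) (F : R -> N) t w a b :
    {morph F : x y / x + y} -> (forall x, F ('X *: x) = w *: F x) ->
  msubst F t (quad_gen a b)
  = w *: F (mconst (circ b a)) + F (mconst (brk b a)) + t *: F (mconst (jmul a b)).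
Proof.
by move=> FD FX; rewrite /quad_gen msubstD // msubstX // !msubst_const // FD FX.
Qed.

(* [p(d)a_lambda q(d)b] = p(-lambda) q(lambda + d) [a_lambda b] *)
Definition quad_lbr f g : modpoly R :=
  msubst (fun a => msubst (quad_gen a) ('X + 'X%:P) g) (- 'X) f.

Lemma quad_genDl b : {morph quad_gen^~ b : a a' / a + a'}.
Proof.
move=> a a'; rewrite /quad_gen /jmul circDl circDr brkDr !mconstD !scalerDr !mconstD.
module_ring.
Qed.

Lemma quad_genDr a : {morph quad_gen a : b b' / b + b'}.
Proof.
move=> b b'; rewrite /quad_gen /jmul circDl circDr brkDl !mconstD !scalerDr !mconstD.
module_ring.
Qed.

Lemma quad_genZl k a b : quad_gen (k *: a) b = k%:P%:P *: quad_gen a b.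
Proof.
rewrite /quad_gen /jmul circZl circZr brkZr !(mconstD, mconstZ).
module_ring.
Qed.

Lemma quad_genZr k a b : quad_gen a (k *: b) = k%:P%:P *: quad_gen a b.
Proof.
rewrite /quad_gen /jmul circZl circZr brkZl !(mconstD, mconstZ).
module_ring.
Qed.

Let genD g : {morph (fun a => msubst (quad_gen a) ('X + 'X%:P) g) : a a' / a + a'}.
Proof. by move=> a a'; apply: msubst_addl => b; apply: quad_genDl. Qed.

Fact quad_lbrDl f f' g : quad_lbr (f + f') g = quad_lbr f g + quad_lbr f' g.
Proof. exact: (msubstD _ (genD g)). Qed.

Fact quad_lbrDr f g g' : quad_lbr f (g + g') = quad_lbr f g + quad_lbr f g'.
Proof. by apply: msubst_addl => a; apply: msubstD; apply: quad_genDr. Qed.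

Fact quad_lbrZl k f g : quad_lbr (k%:P *: f) g = k%:P%:P *: quad_lbr f g.
Proof.
by apply: msubstC => [|a]; [exact: genD | apply: msubst_scalel => b; exact: quad_genZl].
Qed.

Fact quad_lbrZr k f g : quad_lbr f (k%:P *: g) = k%:P%:P *: quad_lbr f g.
Proof.
apply: msubst_scalel => a; apply: msubstC => [|b]; first exact: quad_genDr.
exact: quad_genZr.
Qed.

Fact quad_lbrXl f g : quad_lbr ('X *: f) g = (- 'X) *: quad_lbr f g.
Proof. by apply: msubstX; apply: genD. Qed.

Fact quad_lbrXr f g : quad_lbr f ('X *: g) = ('X + 'X%:P) *: quad_lbr f g.
Proof. by apply: msubst_scalel => a; apply: msubstX; apply: quad_genDr. Qed.

Lemma quad_lbr_const a b : quad_lbr (mconst a) (mconst b) = quad_gen a b.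
Proof.
rewrite /quad_lbr msubst_const; last exact: genD.
by rewrite msubst_const //; apply: quad_genDr.
Qed.

Let D0 : {morph @mconst _ R : x y / x + y}. Proof. exact: mconstD. Qed.

Let SX u (x : modpoly R) : msubst (@mconst _ R) u ('X%:P *: x)
  = 'X%:P *: msubst (@mconst _ R) u x.
Proof. by apply: msubstC => // y; rewrite mconstZ. Qed.

Lemma quad_gen_skew a b :
  quad_gen a b = - msubst (@mconst _ R) (- 'X - 'X%:P) (quad_gen b a).
Proof.
rewrite /quad_gen msubstD // msubstX // !msubst_const // /jmul (brkC b a).
rewrite !(mconstD, mconstN, mconstZ).
module_ring.
Qed.

Fact quad_lbr_skew f g :
  quad_lbr f g = - msubst (@mconst _ R) (- 'X - 'X%:P) (quad_lbr g f).
Proof.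
pose S := msubst (@mconst _ R) (- 'X - 'X%:P).
have SD : {morph S : x y / x + y} by exact: msubstD.
have SX' x : S ('X *: x) = (- 'X - 'X%:P) *: S x by exact: msubstX.
have SC x : S ('X%:P *: x) = 'X%:P *: S x by exact: SX.
have SN x : S (- x) = - S x.
  have S0 : S 0 = 0 by apply: (addrI (S 0)); rewrite -SD !addr0.
  by apply/eqP; rewrite -addr_eq0 -SD addNr S0.
move: f; apply: (@modpoly_eq _ _ _ _ _ _ (- 'X)) => [f f'|f f'|f|f|a].
- exact: quad_lbrDl.
- by rewrite -/S quad_lbrDr SD opprD.
- exact: quad_lbrXl.
- rewrite -/S quad_lbrXr scalerDl SD SX' SC; module_ring.
move: g; apply: (@modpoly_eq _ _ _ _ _ _ ('X + 'X%:P)) => [g g'|g g'|g|g|b].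
- exact: quad_lbrDr.
- by rewrite -/S quad_lbrDl SD opprD.
- exact: quad_lbrXr.
- rewrite -/S quad_lbrXl scaleNr SN SX'; module_ring.
by rewrite !quad_lbr_const quad_gen_skew.
Qed.

Local Notation P3 := {poly {poly {poly K}}}.
Local Notation L := ('X%:P : P3).
Local Notation U := ('X : P3).
Local Notation D := ('X%:P%:P : P3).
Local Notation at_ := (lbr_at quad_lbr).
Let i2 (x : R) : modpoly (modpoly R) := mconst (mconst x).
Let i3 (a : V) : modpoly (modpoly R) := mconst (mconst (mconst a : R)).

Let i2D : {morph i2 : x y / x + y}.
Proof. by move=> x y; rewrite /i2 !mconstD. Qed.

Let i2X (x : R) : i2 ('X *: x) = D *: i2 x.
Proof. by rewrite /i2 !mconstZ. Qed.

Let atDl u f f' g : at_ u (f + f') g = at_ u f g + at_ u f' g.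
Proof. by rewrite /lbr_at quad_lbrDl msubstD. Qed.

Let atDr u f g g' : at_ u f (g + g') = at_ u f g + at_ u f g'.
Proof. by rewrite /lbr_at quad_lbrDr msubstD. Qed.

Let atXl u f g : at_ u ('X *: f) g = (- u) *: at_ u f g.
Proof.
by rewrite /lbr_at quad_lbrXl (msubstNX _ i2D).
Qed.

Let atXr u f g : at_ u f ('X *: g) = (u + D) *: at_ u f g.
Proof.
by rewrite /lbr_at quad_lbrXr (msubstXDC _ i2D _ i2X).
Qed.

Let T u a b := D *: i3 (circ b a) + i3 (brk b a) + u *: i3 (jmul a b).

Let at_const u a b : at_ u (mconst a) (mconst b) = T u a b.
Proof.
by rewrite /lbr_at quad_lbr_const (msubst_quad_gen _ _ _ i2D i2X).
Qed.

Fact quad_lbr_jacobi f g h :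
  msubst (at_ L f) U (quad_lbr g h)
  = msubst (fun x => at_ (L + U) x h) L (quad_lbr f g)
    + msubst (at_ U g) L (quad_lbr f h).
Proof.
pose T1 f g h := msubst (at_ L f) U (quad_lbr g h).
pose T2 f g h := msubst (fun x => at_ (L + U) x h) L (quad_lbr f g).
pose T3 f g h := msubst (at_ U g) L (quad_lbr f h).
have aD u x : {morph at_ u x : y z / y + z} by move=> y z; apply: atDr.
have aD' u x : {morph at_ u^~ x : y z / y + z} by move=> y z; apply: atDl.
have LU : L - (L + U) = - U by rewrite opprD addrA subrr add0r.
rewrite -/(T1 f g h) -/(T2 f g h) -/(T3 f g h).
move: f; apply: (@modpoly_eq _ _ _ _ _ _ (- L)) => [f f'|f f'|f|f|a].
- by apply: msubst_addl => x; apply: atDl.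
- rewrite /T2 /T3 !quad_lbrDl (msubstD _ (aD' _ h)) (msubstD _ (aD _ g)).
  by rewrite addrACA.
- by apply: msubst_scalel => x; apply: atXl.
- by rewrite /T2 /T3 !quad_lbrXl !msubstNX // scalerDr.
move: g; apply: (@modpoly_eq _ _ _ _ _ _ (- U)) => [g g'|g g'|g|g|b].
- by rewrite /T1 quad_lbrDl msubstD.
- rewrite /T2 /T3 quad_lbrDr (msubstD _ (aD' _ h)) addrACA; congr (_ + _).
  by apply: msubst_addl => x; apply: atDl.
- by rewrite /T1 quad_lbrXl msubstNX.
- rewrite /T2 /T3 quad_lbrXr (@msubstXDC _ _ _ _ _ _ _ _ (- (L + U))) //.
  rewrite LU scalerDr; congr (_ + _).
  by apply: msubst_scalel => x; apply: atXl.
move: h; apply: (@modpoly_eq _ _ _ _ _ _ (L + U + D)) => [h h'|h h'|h|h|c].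
- by rewrite /T1 quad_lbrDr msubstD.
- rewrite /T2 /T3 quad_lbrDr (msubstD _ (aD _ (mconst b))) addrACA; congr (_ + _).
  by apply: msubst_addl => x; apply: atDr.
- rewrite /T1 quad_lbrXr (@msubstXDC _ _ _ _ _ _ _ _ (L + D)); [|by []|by move=> x; apply: atXr].
  by rewrite addrA (addrC U).
- rewrite /T2 /T3 quad_lbrXr (@msubstXDC _ _ _ _ _ _ _ _ (U + D)); [|by []|by move=> x; apply: atXr].
  rewrite scalerDr addrA; congr (_ + _).
  by apply: msubst_scalel => x; apply: atXr.
rewrite /T1 /T2 /T3 !quad_lbr_const.
rewrite (@msubst_quad_gen _ _ _ _ (L + D)) //.
rewrite (@msubst_quad_gen _ _ _ _ (- (L + U))) //.
rewrite (@msubst_quad_gen _ _ _ _ (U + D)) //.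
rewrite !at_const; apply: gd_jacobi => [x y|x].
  by rewrite /i3 !mconstD.
by rewrite /i3 !mconstN.
Qed.

HB.instance Definition _ := PolyLmodule_isLieConformal.Build K (quadratic V)
  quad_lbrDl quad_lbrDr quad_lbrZl quad_lbrZr quad_lbrXl quad_lbrXr
  quad_lbr_skew quad_lbr_jacobi.

End Quadratic.

(* Main.v *)
(** For f = sum_(k <= n) d^k f_k and a in V, the bracket [a_lambda f] equals
    sum_k (lambda + d)^k (d (f_k o a) + [f_k, a] + lambda (a * f_k)), whose
    coefficient in lambda^(n+1) is a * f_n. Hence, if I is an ideal of R, then
    I ∩ V is an ideal of (V, * ) that contains all products a * f_n with f in I.
    If I ∩ V = V then I = R; if I ∩ V = 0 and f_n <> 0 then f_n lies in the
    annihilator of (V, * ), which is a proper ideal and thus zero. *)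
Require Import Defs.
From HB Require Import structures.
From mathcomp Require Import all_boot all_order all_algebra.
From mathcomp Require Import finmap monalg.
From mathcomp Require Import boolp classical_sets reals complex.

Set Implicit Arguments.
Unset Strict Implicit.
Unset Printing Implicit Defensive.

Import GRing.Theory.
Local Open Scope ring_scope.
Local Open Scope classical_set_scope.

(** The power is monic of degree [k]. It is used with [c] equal to d, for the factor (lambda + d)^k
    in the bracket of a constant with d^k f_k. *)
Lemma coef_XDC_exp (A : comNzRingType) (c : A) (k n : nat) :
  (k <= n)%N -> (('X + c%:P) ^+ k)`_n = (k == n)%:R.
Proof.
have sz : size (('X + c%:P) ^+ k) = k.+1 by rewrite -[c]opprK polyCN size_exp_XsubC.
have lc : (('X + c%:P) ^+ k)`_k = 1.
  by have /monicP := monic_exp k (monicXsubC (- c)); rewrite polyCN opprK lead_coefE sz.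
by rewrite leq_eqVlt => /predU1P[<-|kn]; rewrite ?eqxx // nth_default ?sz // ltn_eqF.
Qed.

Section Coefficients.
Variables (A : comNzRingType) (M : lmodType A).
Implicit Types (x : M) (f : modpoly M).

Lemma mcoeff_mconst x n : (mconst x)@_n = if n == 0%N then x else 0.
Proof. by rewrite mconst.unlock mcoeffU eq_sym; case: eqP. Qed.

Lemma mconst0 : mconst (0 : M) = 0.
Proof. by apply/malgP => n; rewrite mcoeff_mconst mcoeff0 if_same. Qed.

Lemma mconst_inj : injective (@mconst A M).
Proof. by move=> x y /(congr1 (mcoeff 0%N)); rewrite !mcoeff_mconst. Qed.

Lemma mcoeff_mscaleX f n : ('X *: f)@_n = if n is m.+1 then f@_m else 0.
Proof.
rewrite -['X](scale1r ('X : {poly A})) -{1}['X]expr1 mcoeff_scaleXn scale1r.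
by case: n => [|n] //=; rewrite subn1.
Qed.

(** The coefficient is a convolution sum. Since [g] is affine in lambda, only the indices [n] and
    [n.+1] of [p] could contribute, and the second gives zero because [p] vanishes there. *)
Lemma mcoeff_scale_affine (g : modpoly M) (p : {poly A}) n :
  (forall k, (1 < k)%N -> g@_k = 0) -> p`_n.+1 = 0 ->
  (p *: g)@_n.+1 = p`_n *: g@_1.
Proof.
move=> g_deg pn; rewrite [LHS]modpoly_scaleE big_ord_recr big_ord_recr /=.
rewrite pn scale0r addr0 subSnn big1 ?add0r // => i _.
by rewrite g_deg ?scaler0 //= ltn_subRL addn1 ltnS.
Qed.

Lemma modpoly_lead f :
  f != 0 -> exists n, f@_n != 0 /\ forall k, (n < k)%N -> f@_k = 0.
Proof.
move=> f0; have ex : exists n, n \in msupp f.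
  have : msupp f != fset0.
    apply: contraNneq f0 => s0; apply/eqP/malgP => k.
    by rewrite mcoeff0 mcoeff_outdom ?s0.
  by case/fset0Pn => n nf; exists n.
have ub i : i \in msupp f -> (i <= \max_(j <- msupp f) j)%N.
  by move=> fi; apply: leq_bigmax_seq.
case: (ex_maxnP ex ub) => n; rewrite -mcoeff_neq0 => fn max_n; exists n; split=> // k nk.
by apply/eqP/negPn/negP; rewrite mcoeff_neq0 => /max_n; rewrite leqNgt nk.
Qed.

End Coefficients.

Section QuadraticIdeals.
Variables (K : fieldType) (V : gelfandDorfmanType K).
Implicit Types (a b : V) (f : quadratic V) (I : set (quadratic V)).

Lemma mcoeff_quad_gen1 a b : (quad_gen a b)@_1 = mconst (jmul a b).
Proof.
by rewrite /quad_gen mcoeffD mcoeff_mscaleX /= !mcoeff_mconst add0r.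
Qed.

Lemma mcoeff_quad_gen_gt1 a b k : (1 < k)%N -> (quad_gen a b)@_k = 0.
Proof.
case: k => [|[|k]] // _.
by rewrite /quad_gen mcoeffD mcoeff_mscaleX /= !mcoeff_mconst add0r.
Qed.

(** Each (lambda + d)^k [quad_gen a f@_k] has degree at most k + 1 in lambda, so only k = n reaches
    lambda^(n+1), through the monic top term and the lambda-part of [quad_gen]. The value [f@_n] may
    be zero. *)
Lemma mcoeff_lbr_lead a f n : (forall k, (n < k)%N -> f@_k = 0) ->
  (lbr (mconst a : quadratic V) f)@_n.+1 = mconst (jmul a f@_n).
Proof.
move=> f_deg.
(* A constant first argument has no power of d, hence brings no factor -lambda. *)
have -> : lbr (mconst a : quadratic V) f = msubst (quad_gen a) ('X + 'X%:P) f.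
  rewrite [LHS]/(quad_lbr _ _) /quad_lbr msubst_const // => x y.
  by apply: msubst_addl => b; exact: quad_genDl.
rewrite msubst.unlock raddf_sum /=.
have term k : k \in msupp f ->
    ((('X + 'X%:P) ^+ k : {poly {poly K}}) *: quad_gen a f@_k)@_n.+1
    = if k == n then mconst (jmul a f@_n) else 0.
  move=> kf; have kn : (k <= n)%N.
    by rewrite leqNgt; apply/negP => /f_deg /eqP; apply/negP; rewrite mcoeff_neq0.
  rewrite mcoeff_scale_affine; last by rewrite coef_XDC_exp ?leqW // ltn_eqF.
    rewrite coef_XDC_exp // mcoeff_quad_gen1.
    by case: eqP => [->|_]; rewrite ?scale1r ?scale0r.
  by move=> j; exact: mcoeff_quad_gen_gt1.
rewrite (eq_big_seq _ term) -big_mkcond /=.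
(* Outside the support the sum has no term of index [n], and the right side is also zero because a *
   0 = 0. *)
have [nf|nf] := boolP (n \in msupp f).
  rewrite (big_rem n nf) /= eqxx big1_seq ?addr0 // => k.
  by rewrite mem_rem_uniq ?fset_uniq // inE => /and3P[/eqP->]; rewrite eqxx.
rewrite big1_seq => [|k /andP[/eqP-> nf']]; last by rewrite nf' in nf.
by rewrite (mcoeff_outdom nf) /jmul circ0l circ0r addr0 mconst0.
Qed.

Lemma mcoeff_lbr_const a b :
  (lbr (mconst a : quadratic V) (mconst b))@_1 = mconst (jmul a b).
Proof.
by rewrite mcoeff_lbr_lead => [|[|k]] //; rewrite mcoeff_mconst.
Qed.

Lemma mem_bracket_set (R : lieConformalType K) (S T : set R) (x y : R) n :
  S x -> T y -> bracket_set S T (lbr x y)@_n.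
Proof.
move=> Sx Ty; exists [:: (1, (lbr x y)@_n)]; split; last by rewrite big_seq1 /= scale1r.
by move=> z; rewrite inE => /eqP -> /=; exists x, y, n.
Qed.

Lemma jmulC a b : jmul a b = jmul b a.
Proof. exact: addrC. Qed.

Lemma submod_closed_set (A : nzRingType) (M : lmodType A) (S : set M) :
  S 0 -> (forall c x y, S x -> S y -> S (c *: x + y)) ->
  GRing.submod_closed [in S].
Proof.
by move=> S0 SD; split=> [|c x y]; rewrite !inE //; exact: SD.
Qed.

Lemma submod_closed_setP (A : nzRingType) (M : lmodType A) (S : set M) :
  GRing.submod_closed [in S] ->
  S 0 /\ forall c x y, S x -> S y -> S (c *: x + y).
Proof.
case=> S0 SD; split=> [|c x y Sx Sy]; first by rewrite inE in S0.
by have := SD c x y; rewrite !inE; apply.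
Qed.

Lemma nj_ideal_constants I :
  lca_ideal I -> nj_ideal [set a : V | I (mconst a)].
Proof.
case=> /submod_closed_setP[I0 IZD] I_br; split.
  apply: submod_closed_set => [|c x y Ix Iy] /=.
    by rewrite mconst0.
  by rewrite mconstD mconstZ; exact: IZD.
(* The product is commuted because a Lie conformal ideal absorbs brackets with its element in the
   second slot. *)
move=> a b /= Ia; rewrite jmulC -mcoeff_lbr_const.
by apply: I_br; apply: mem_bracket_set.
Qed.

(** Absorption is immediate: a product with an annihilating element is 0, which annihilates
    everything. *)
Lemma nj_ideal_annihilator : nj_ideal [set b : V | forall a, jmul a b = 0].
Proof.
split; last first.
  by move=> b a annb c; rewrite (jmulC b) annb /jmul circ0l circ0r addr0.
apply: submod_closed_set => [a|k x y annx anny a].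
  by rewrite /jmul circ0l circ0r addr0.
rewrite /jmul circDl circDr circZl circZr addrACA -scalerDr.
by rewrite [X in k *: X]annx [X in _ + X]anny scaler0 addr0.
Qed.

Lemma nj_simple_nondegenerate b :
  nj_simple V -> (forall a, jmul a b = 0) -> b = 0.
Proof.
case=> V_ideals [c [d cd]] annb.
case: (V_ideals _ nj_ideal_annihilator) => annE.
  by have : [set b : V | forall a, jmul a b = 0] b by []; rewrite annE.
(* If the annihilator were all of V, it would contain [d], against c * d being nonzero. *)
by case: cd; have : [set: V] d by []; rewrite -annE; apply.
Qed.

Lemma nj_simple_lca_simple : nj_simple V -> lca_simple (quadratic V).
Proof.
move=> V_simple; split=> [R_abelian|I I_ideal].
  have [_ [a [b ab]]] := V_simple; apply: ab; apply: mconst_inj.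
  rewrite -mcoeff_lbr_const.
  have : bracket_set [set: quadratic V] setT (lbr (mconst a : quadratic V) (mconst b))@_1.
    exact: mem_bracket_set.
  by rewrite R_abelian => ->; rewrite mconst0.
have [/submod_closed_setP[I0 IZD] I_br] := I_ideal.
case: (V_simple.1 _ (nj_ideal_constants I_ideal)) => IV.
  left; apply/seteqP; split=> [f If|f ->] //=.
  apply/eqP/negPn/negP => /modpoly_lead[n [/eqP fn f_deg]]; apply: fn.
  apply: nj_simple_nondegenerate => // a.
  (* No nonzero constant lies in [I], so it suffices that the constant a * f_n, a coefficient of a
     bracket with [f], does. *)
  suff : [set a : V | I (mconst a)] (jmul a f@_n) by rewrite IV.
  by rewrite /= -mcoeff_lbr_lead //; apply: I_br; apply: mem_bracket_set.
(* Every f is a sum of terms d^k f_k with f_k constant, and [I] is stable under d. *)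
right; apply/seteqP; split=> // f _; rewrite [f]modpolyE.
elim/big_rec: _ => // k g _ Ig; apply: IZD => //.
by have : [set: V] f@_k by []; rewrite -IV.
Qed.

End QuadraticIdeals.

Theorem proposition3p9 (R : realType) (V : gelfandDorfmanType R[i]) :
  nj_simple V -> lca_simple (quadratic V).
Proof. exact: nj_simple_lca_simple. Qed.
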